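(* (Weak Soundness) For every $(n,k)\in\omega^2$ and every $\phi\in L(C)$: if $\vdash_{(n,k)}\phi$, then $\models_{(n,k)}\phi$.
   Context: $\omega=\{0,1,2,\dots\}$. Let $\mathcal V$ be a countable set of atomic formulas, and let $L(C)$ be the set of formulas freely generated from $\mathcal V$ by the connectives $C=\{\neg,\rightarrow\}$ ($\neg$ unary, $\rightarrow$ binary). Semantics. For $(n,k)\in\omega^2$, the matrix $M_{(n,k)}$ has the set of truth-values $A_{(n,k)}=\{F_0,\dots,F_n,T_0,\dots,T_k\}$ ($n+k+2$ distinct elements), the set of designated values $D_{(n,k)}=\{T_0,\dots,T_k\}$, and the operations: $\neg F_0=T_0$, $\neg T_0=F_0$, $\neg F_r=F_{r-1}$ for $1\le r\le n$, $\neg T_i=T_{i-1}$ for $1\le i\le k$; $A\rightarrow B=F_0$ if $A\in D_{(n,k)}$ and $B\notin D_{(n,k)}$, and $A\rightarrow B=T_0$ otherwise. An $M_{(n,k)}$-valuation is a homomorphism $v:L(C)\to A_{(n,k)}$. $\Gamma\models_{(n,k)}\phi$ means: for every $M_{(n,k)}$-valuation $v$, $v(\Gamma)\subseteq D_{(n,k)}$ implies $v(\phi)\in D_{(n,k)}$; $\models_{(n,k)}\phi$ means $\emptyset\models_{(n,k)}\phi$. Secondary connectives (abbreviations in $L(C)$): $\copyright\phi:=(\phi\rightarrow\phi)\rightarrow\phi$; $\sim\phi:=\neg(\copyright\phi)$; $\phi\vee\psi:=\,\sim\phi\rightarrow\psi$; $\phi\wedge\psi:=\,\sim(\phi\rightarrow\sim\psi)$;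 $\phi^{\ast}:=\neg\phi\vee\phi$; $\phi^{\circ}:=\neg(\neg\phi\wedge\phi)$; $\neg^q\phi$ is $\phi$ preceded by $q$ negations ($\neg^0\phi=\phi$). Axiomatics. $\vdash_{(n,k)}$ is the Hilbert-style consequence relation ($\Gamma\vdash_{(n,k)}\phi$ iff there is a finite formal proof of $\phi$ from hypotheses in $\Gamma$; $\vdash_{(n,k)}\phi$ means $\emptyset\vdash_{(n,k)}\phi$) whose only inference rule is Modus Ponens (from $\phi$ and $\phi\rightarrow\psi$ infer $\psi$) and whose axiom schemas are: $Ax_1$: $\phi\rightarrow(\psi\rightarrow\phi)$; $Ax_2$: $(\phi\rightarrow(\psi\rightarrow\theta))\rightarrow((\phi\rightarrow\psi)\rightarrow(\phi\rightarrow\theta))$; $Ax_3$: $(\phi\rightarrow\psi)^{\ast}$; $Ax_4$: $(\phi\rightarrow\psi)^{\circ}$; $Ax_5$: $(\neg^n\phi)^{\ast}$; $Ax_6$: $(\neg^k\phi)^{\circ}$; $Ax_7$: $\phi^{\ast}\rightarrow[\psi^{\circ}\rightarrow((\neg\phi\rightarrow\neg\psi)\rightarrow((\neg\phi\rightarrow\psi)\rightarrow\phi))]$; $Ax_8$: $\phi^{\ast}\rightarrow[\psi^{\circ}\rightarrow((\phi\rightarrow\neg\psi)\rightarrow((\phi\rightarrow\psi)\rightarrow\neg\phi))]$; $Ax_9$: $\phi^{\ast}\rightarrow(\neg\neg\phi\rightarrow\phi)$; $Ax_{10}$: $\phi^{\circ}\rightarrow(\phi\rightarrow\neg\neg\phi)$;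 $Ax_{11}$: $\phi^{\ast}\rightarrow(\neg\phi)^{\ast}$; $Ax_{12}$: $\phi^{\circ}\rightarrow(\neg\phi)^{\circ}$. *)

(* Defs.v *)
From mathcomp Require Import all_boot.

Set Implicit Arguments.
Unset Strict Implicit.
Unset Printing Implicit Defensive.

Inductive formula (V : Type) : Type :=
| Atom of V
| Neg of formula V
| Imp of formula V & formula V.

Declare Scope form_scope.
Delimit Scope form_scope with form.
Bind Scope form_scope with formula.
Notation "A ==> B" := (Imp A B) : form_scope.

Section Connectives.
Local Open Scope form_scope.
Variable V : Type.
Implicit Types A B : formula V.

Definition copyr A := (A ==> A) ==> A.
Definition cneg A := Neg (copyr A).
Definition fdisj A B := cneg A ==> B.
Definition fconj A B := cneg (A ==> cneg B).
Definition star A := fdisj (Neg A) A.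
Definition circ A := Neg (fconj (Neg A) A).
Definition negn (q : nat) A := iter q (@Neg V) A.

End Connectives.

(* [TF r] is F_r for 0 <= r <= n, and [TT i] is T_i for 0 <= i <= k. *)
Inductive tval (n k : nat) : Type :=
| TF of 'I_n.+1
| TT of 'I_k.+1.

Section Matrix.
Variables n k : nat.
Implicit Types a b : tval n k.

Definition designated a : bool := if a is TT _ then true else false.

Definition tneg a : tval n k :=
  match a with
  | TF r => if r == ord0 then TT n ord0 else TF k (inord r.-1)
  | TT i => if i == ord0 then TF k ord0 else TT n (inord i.-1)
  end.

Definition timp a b : tval n k :=
  if designated a && ~~ designated b then TF k ord0 else TT n ord0.

Definition valuation (V : Type) (v : formula V -> tval n k) : Prop :=
  (forall A, v (Neg A) = tneg (v A)) /\
  (forall A B, v (Imp A B) = timp (v A) (v B)).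

End Matrix.

Definition entails (n k : nat) (V : Type) (Gamma : formula V -> Prop)
    (A : formula V) : Prop :=
  forall v : formula V -> tval n k, valuation v ->
    (forall B, Gamma B -> designated (v B)) -> designated (v A).

Section Hilbert.
Local Open Scope form_scope.
Variables (n k : nat) (V : Type).
Implicit Types A B C : formula V.

Inductive axiom : formula V -> Prop :=
| Ax1 A B : axiom (A ==> (B ==> A))
| Ax2 A B C : axiom ((A ==> (B ==> C)) ==> ((A ==> B) ==> (A ==> C)))
| Ax3 A B : axiom (star (A ==> B))
| Ax4 A B : axiom (circ (A ==> B))
| Ax5 A : axiom (star (negn n A))
| Ax6 A : axiom (circ (negn k A))
| Ax7 A B : axiom (star A ==> (circ B ==>
    ((Neg A ==> Neg B) ==> ((Neg A ==> B) ==> A))))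
| Ax8 A B : axiom (star A ==> (circ B ==>
    ((A ==> Neg B) ==> ((A ==> B) ==> Neg A))))
| Ax9 A : axiom (star A ==> (Neg (Neg A) ==> A))
| Ax10 A : axiom (circ A ==> (A ==> Neg (Neg A)))
| Ax11 A : axiom (star A ==> star (Neg A))
| Ax12 A : axiom (circ A ==> circ (Neg A)).

Definition formal_proof (Gamma : formula V -> Prop) (s : seq (formula V)) :=
  forall i A, onth s i = Some A ->
    [\/ Gamma A, axiom A
      | exists j l B, [/\ j < i, l < i, onth s j = Some B
                        & onth s l = Some (B ==> A)]].

Definition derives (Gamma : formula V -> Prop) (A : formula V) : Prop :=
  exists s, formal_proof Gamma (rcons s A).

End Hilbert.

Definition no_hyp (V : Type) : formula V -> Prop := fun _ => False.

(* Main.v *)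
(** A value outside [D] has an F-index and a designated one a T-index; setting
    the missing index to 0, negation decrements both indices.  The formula
    [star A] holds exactly when the F-index of [A] is 0, and [circ A] exactly
    when the T-index is 0, so [n] (resp. [k]) negations secure the former
    (resp. the latter).  Modulo these facts every axiom schema becomes a
    propositional tautology. *)
Require Import Defs.
From mathcomp Require Import all_boot.

Set Implicit Arguments.
Unset Strict Implicit.
Unset Printing Implicit Defensive.

Section Indices.
Variables n k : nat.
Implicit Types a b : Defs.tval n k.

Definition findex a : nat := if a is TF r then r else 0.
Definition tindex a : nat := if a is TT i then i else 0.

(** The truncated predecessor fits the crossings too: swapping [F_0] and [T_0] leaves both indices
    at 0. *)
Lemma findex_tneg a : findex (tneg a) = (findex a).-1.
Proof.
case: a => i /=; case: eqP => //= [-> //|_].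
by rewrite inordK // ltnS (leq_trans (leq_pred _)) // -ltnS.
Qed.

Lemma tindex_tneg a : tindex (tneg a) = (tindex a).-1.
Proof.
case: a => i /=; case: eqP => //= [-> //|_].
by rewrite inordK // ltnS (leq_trans (leq_pred _)) // -ltnS.
Qed.

Lemma findex_iter m a : findex (iter m (@tneg n k) a) = findex a - m.
Proof. by elim: m => [|m IHm]; rewrite ?subn0 //= findex_tneg IHm subnS. Qed.

Lemma tindex_iter m a : tindex (iter m (@tneg n k) a) = tindex a - m.
Proof. by elim: m => [|m IHm]; rewrite ?subn0 //= tindex_tneg IHm subnS. Qed.

Lemma findex_le a : findex a <= n.
Proof. by case: a => //= r; rewrite -ltnS. Qed.

Lemma tindex_le a : tindex a <= k.
Proof. by case: a => //= i; rewrite -ltnS. Qed.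

Lemma designated_findex a : designated a -> findex a = 0.
Proof. by case: a. Qed.

Lemma undesignated_tindex a : ~~ designated a -> tindex a = 0.
Proof. by case: a. Qed.

(** Negation crosses between designated and undesignated values only at [F_0] and [T_0]; elsewhere
    it stays on its side. *)
Lemma designated_tneg a :
  designated (tneg a) =
  if designated a then tindex a != 0 else findex a == 0.
Proof. by case: a => i /=; rewrite -val_eqE /=; case: (val i == 0). Qed.

Lemma designated_timp a b :
  designated (timp a b) = (designated a ==> designated b).
Proof. by rewrite /timp; case: (designated a); case: (designated b). Qed.

Lemma findex_timp a b : findex (timp a b) = 0.
Proof. by rewrite /timp; case: ifP. Qed.

Lemma tindex_timp a b : tindex (timp a b) = 0.
Proof. by rewrite /timp; case: ifP. Qed.

End Indices.

Section Soundness.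
Variables (n k : nat) (V : Type) (v : formula V -> Defs.tval n k).
Hypothesis v_val : valuation v.
Implicit Types A B : formula V.

Lemma valuation_neg A : v (Neg A) = tneg (v A).
Proof. exact: v_val.1. Qed.

Lemma valuation_imp A B : v (Imp A B) = timp (v A) (v B).
Proof. exact: v_val.2. Qed.

Lemma valuation_negn m A : v (Defs.negn m A) = iter m (@tneg n k) (v A).
Proof. by elim: m => //= m IHm; rewrite valuation_neg IHm. Qed.

Lemma designated_imp A B :
  designated (v (Imp A B)) = (designated (v A) ==> designated (v B)).
Proof. by rewrite valuation_imp designated_timp. Qed.

(** An implication only takes the values [F_0] and [T_0], where negation is classical. Since
    [copyr A] is an implication designated exactly when [A] is, [cneg] is classical on every
    formula. *)
Lemma designated_neg_imp A B :
  designated (v (Neg (Imp A B))) = ~~ designated (v (Imp A B)).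
Proof.
rewrite valuation_neg designated_tneg valuation_imp findex_timp tindex_timp.
by case: designated.
Qed.

Lemma designated_cneg A : designated (v (cneg A)) = ~~ designated (v A).
Proof.
by rewrite designated_neg_imp !designated_imp; case: (designated (v A)).
Qed.

Lemma designated_fconj A B :
  designated (v (fconj A B)) = designated (v A) && designated (v B).
Proof.
by rewrite designated_cneg designated_imp designated_cneg negb_imply negbK.
Qed.

Lemma designated_star A : designated (v (star A)) = (findex (v A) == 0).
Proof.
rewrite designated_imp designated_cneg valuation_neg designated_tneg.
have := @designated_findex _ _ (v A).
by case: (designated (v A)) => [->|_] //; [rewrite implybT | case: eqP].
Qed.

Lemma designated_circ A : designated (v (circ A)) = (tindex (v A) == 0).
Proof.
set X := fconj (Neg A) A.
(* [X] is itself the negation of an implication, so its value is [F_0] or [T_0] and the outer [Neg]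
   acts on it classically. *)
have [fX0 tX0] : findex (v X) = 0 /\ tindex (v X) = 0.
  rewrite /X /fconj /cneg /copyr valuation_neg valuation_imp.
  by rewrite findex_tneg tindex_tneg findex_timp tindex_timp.
rewrite /circ -/X valuation_neg designated_tneg fX0 tX0.
rewrite designated_fconj valuation_neg designated_tneg.
have := @undesignated_tindex _ _ (v A).
by case: (designated (v A)) => [_|->] //=; rewrite ?andbT ?andbF; case: eqP.
Qed.

Lemma axiom_designated A : axiom n k A -> designated (v A).
Proof.
case=> {}A.
1-2: move=> B *; rewrite !designated_imp.
1-2: by do ![case: (designated _) => //].
- by move=> B; rewrite designated_star valuation_imp findex_timp.
- by move=> B; rewrite designated_circ valuation_imp tindex_timp.
- by rewrite designated_star valuation_negn findex_iter subn_eq0 findex_le.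
- by rewrite designated_circ valuation_negn tindex_iter subn_eq0 tindex_le.
(* In Ax7 and Ax8, T-index 0 for [B] excludes that [B] and [Neg B] are both designated, and F-index
   0 for [A] makes [A] or [Neg A] designated. *)
- move=> B; rewrite designated_imp designated_star designated_imp designated_circ.
  rewrite !designated_imp !valuation_neg !designated_tneg.
  case: (designated (v A)); case: (designated (v B)) => //=;
    case: (findex (v A) == 0) => //=; case: (tindex (v B) == 0) => //=;
    by rewrite ?implybT.
- move=> B; rewrite designated_imp designated_star designated_imp designated_circ.
  rewrite !designated_imp !valuation_neg !designated_tneg.
  case: (designated (v A)); case: (designated (v B)) => //=;
    case: (findex (v A) == 0) => //=; case: (tindex (v B) == 0) => //=;
    by rewrite ?implybT.
(* An undesignated value of F-index 0 is [F_0], which double negation fixes; Ax10 is the dual case,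
   with [T_0]. *)
- rewrite designated_imp designated_star designated_imp.
  rewrite !valuation_neg !designated_tneg findex_tneg tindex_tneg.
  have := @undesignated_tindex _ _ (v A).
  by case: (designated (v A)) => [_|->] //; [rewrite !implybT | case: (findex _)].
- rewrite designated_imp designated_circ designated_imp.
  rewrite !valuation_neg !designated_tneg findex_tneg tindex_tneg.
  have := @designated_findex _ _ (v A).
  by case: (designated (v A)) => [->|_] //; [case: (tindex _) | rewrite implybT].
- by rewrite designated_imp !designated_star valuation_neg findex_tneg; case: findex.
- by rewrite designated_imp !designated_circ valuation_neg tindex_tneg; case: tindex.
Qed.

End Soundness.

Lemma derives_entails (n k : nat) (V : Type) (Gamma : formula V -> Prop) A :
  derives n k Gamma A -> entails n k Gamma A.
Proof.
case=> s s_proof v v_val v_Gamma.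
(* Modus ponens may cite any two earlier lines, so the claim is strengthened to all positions and
   proved by strong induction; [A] stands at position [size s]. *)
suff /(_ (size s) A): forall i B, onth (rcons s A) i = Some B -> designated (v B).
  by apply; rewrite onthE map_rcons nth_rcons size_map ltnn eqxx.
elim/ltn_ind=> i IHi B /s_proof[/v_Gamma // | /(axiom_designated v_val) // |].
move=> [j [l [C [ltji ltli /(IHi _ ltji) vC /(IHi _ ltli)]]]].
by rewrite designated_imp // vC.
Qed.

Theorem theorem4p1 (V : countType) (n k : nat) (phi : formula V) :
  derives n k (@no_hyp V) phi -> entails n k (@no_hyp V) phi.
Proof. exact: derives_entails. Qed.
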